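(* Let $X$ be a set. For every perfect map $f\colon\mathbb{V}^{\uparrow}(([0,1]^{\uparrow})^X)\to[0,1]^{\uparrow}$ there exist an at most countable set $Y$, a perfect map $s\colon([0,1]^{\uparrow})^Y\to[0,1]^{\uparrow}$ and a family $(h_y\colon([0,1]^{\uparrow})^X\to[0,1]^{\uparrow})_{y\in Y}$ of perfect maps such that $f=s\circ\langle\Box\circ\mathbb{V}^{\uparrow}h_y\rangle_{y\in Y}$.
   Context: A stably compact space is a $T_0$ space that is compact, locally compact, coherent (intersection of two compact saturated sets is compact) and well-filtered; a perfect map is a continuous map such that preimages of compact saturated sets are compact saturated. The order on such a space is the specialization order; $\uparrow$ denotes up-closure. $[0,1]^{\uparrow}$ is the set $[0,1]$ with the topology of Euclidean-open upsets, and $([0,1]^{\uparrow})^X$ carries the product topology (a stably compact space). For a stably compact $Z$, $\mathbb{V}^{\uparrow}Z$ is the set of compact saturated subsets of $Z$ with topology generated by $\{K\mid K\subseteq U\}$ ($U$ open), and $\mathbb{V}^{\uparrow}h(K)=\uparrow h[K]$. $\Box\colon\mathbb{V}^{\uparrow}([0,1]^{\uparrow})\to[0,1]^{\uparrow}$ is $A\mapsto\inf A$ (with $\inf\varnothing=1$). $\langle g_y\rangle_{y\in Y}$ denotes the induced map into the product. *)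

(* Defs.v *)
From Stdlib Require Import Reals Lra List.
From Coquelicot Require Import Coquelicot.
Open Scope R_scope.

Definition continuous_map {T1 T2 : Type} (O1 : (T1 -> Prop) -> Prop)
  (O2 : (T2 -> Prop) -> Prop) (f : T1 -> T2) : Prop :=
  forall U, O2 U -> O1 (fun x => U (f x)).

Definition compact_set {T : Type} (O : (T -> Prop) -> Prop) (K : T -> Prop) : Prop :=
  forall (I : Type) (U : I -> T -> Prop),
    (forall i, O (U i)) ->
    (forall x, K x -> exists i, U i x) ->
    exists l : list I, forall x, K x -> exists i, In i l /\ U i x.

Definition saturated_set {T : Type} (O : (T -> Prop) -> Prop) (K : T -> Prop) : Prop :=
  forall x, (forall U, O U -> (forall y, K y -> U y) -> U x) -> K x.

Definition spec_le {T : Type} (O : (T -> Prop) -> Prop) (x y : T) : Prop :=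
  forall U, O U -> U x -> U y.

Definition upclosure {T : Type} (O : (T -> Prop) -> Prop) (A : T -> Prop) : T -> Prop :=
  fun y => exists x, A x /\ spec_le O x y.

Definition perfect_map {T1 T2 : Type} (O1 : (T1 -> Prop) -> Prop)
  (O2 : (T2 -> Prop) -> Prop) (f : T1 -> T2) : Prop :=
  continuous_map O1 O2 f /\
  forall K, compact_set O2 K -> saturated_set O2 K ->
    compact_set O1 (fun x => K (f x)) /\ saturated_set O1 (fun x => K (f x)).

Definition generated {T : Type} (S : (T -> Prop) -> Prop) (U : T -> Prop) : Prop :=
  forall x, U x -> exists l : list (T -> Prop),
    (forall V, In V l -> S V) /\ (forall V, In V l -> V x) /\
    (forall y, (forall V, In V l -> V y) -> U y).

Definition I01 : Type := { x : R | 0 <= x <= 1 }.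

Definition up_open (U : I01 -> Prop) : Prop :=
  (forall x y : I01, U x -> proj1_sig x <= proj1_sig y -> U y) /\
  (forall x : I01, U x -> exists eps, 0 < eps /\
     forall y : I01, Rabs (proj1_sig y - proj1_sig x) < eps -> U y).

Definition prod_open (X : Type) : ((X -> I01) -> Prop) -> Prop :=
  generated (fun V => exists (i : X) (U : I01 -> Prop), up_open U /\
                         V = (fun g => U (g i))).

Definition VU {T : Type} (O : (T -> Prop) -> Prop) : Type :=
  { K : T -> Prop | compact_set O K /\ saturated_set O K }.

Definition VU_open {T : Type} (O : (T -> Prop) -> Prop) : (VU O -> Prop) -> Prop :=
  generated (fun W => exists U, O U /\
               W = (fun K : VU O => forall x, proj1_sig K x -> U x)).

Definition Vup_map {T1 T2 : Type} (O2 : (T2 -> Prop) -> Prop) (h : T1 -> T2)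
  (K : T1 -> Prop) : T2 -> Prop :=
  upclosure O2 (fun y => exists x, K x /\ h x = y).

(** * Box : A |-> inf A, with inf of the empty set = 1 *)
Definition inf01_R (A : I01 -> Prop) : R :=
  match Glb_Rbar (fun r => exists a : I01, A a /\ proj1_sig a = r) with
  | Finite r => r
  | _ => 1
  end.

(** clamping into [0,1]; it does not change inf01_R (which already lies in
    [0,1]), it only provides the membership proof *)
Definition clamp01 (r : R) : R := Rmax 0 (Rmin 1 r).

Lemma clamp01_in (r : R) : 0 <= clamp01 r <= 1.
Proof.
  unfold clamp01. split.
  - apply Rmax_l.
  - apply Rmax_lub; [lra | apply Rmin_l].
Qed.

Definition box (A : I01 -> Prop) : I01 :=
  exist _ (clamp01 (inf01_R A)) (clamp01_in (inf01_R A)).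

Definition at_most_countable (Y : Type) : Prop :=
  exists g : Y -> nat, forall y1 y2, g y1 = g y2 -> y1 = y2.

(* Main.v *)
(** For [c] and [e > 0], the set [{K | c <= f K}] is compact and contained in the open set
    [{K | c - e < f K}], which is a union of sets [{K | K included in U}]; Urysohn functions between
    compact sets and open neighbourhoods then give finitely many perfect [h] such that
    [inf_K h = 1] for one of them when [c <= f K], while [inf_K h > 0] forces [c - e < f K].
    Running [c] through a finite grid, [f K] is approximated within [e] by a finite maximum of
    terms [c * inf_K h].  Doing this for [e = 2^-n] uses countably many functions [h]; the
    approximants, as functions on the countable power of [[0,1]], are turned into a sequence that
    converges uniformly everywhere by limiting the [n]-th step to [2^-n], and [s] is its limit.
    Perfection of [s] rests on Tychonoff's theorem for a countable power. *)
Require Import Defs.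
From Stdlib Require Import Reals.
From Stdlib Require Import Lra Lia List Classical ClassicalEpsilon Cantor.
From Coquelicot Require Import Rcomplements Rbar Lub.
Import ListNotations.
Open Scope R_scope.

(** * The unit interval and clamping *)

Local Notation val x := (proj1_sig (x : I01)).

Definition clampI (r : R) : I01 := exist _ (clamp01 r) (clamp01_in r).

Lemma val_range (x : I01) : 0 <= val x <= 1.
Proof. exact (proj2_sig x). Qed.

Lemma val_inj (x y : I01) : val x = val y -> x = y.
Proof. intros H. apply eq_sig_hprop; [intros; apply proof_irrelevance | exact H]. Qed.

Lemma clamp01_id (r : R) : 0 <= r <= 1 -> clamp01 r = r.
Proof. intros H. unfold clamp01. rewrite Rmin_right, Rmax_right; lra. Qed.

Lemma clamp01_lt (r t d : R) : 0 < d -> r < t + d -> clamp01 r < clamp01 t + d.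
Proof.
  intros Hd H. unfold clamp01, Rmax, Rmin.
  repeat destruct Rle_dec; lra.
Qed.

Lemma clamp01_ge (r t : R) : 0 < r <= 1 -> (r <= clamp01 t <-> r <= t).
Proof.
  intros H. unfold clamp01, Rmax, Rmin.
  repeat destruct Rle_dec; split; lra.
Qed.

(** * Opens and compacts *)

Lemma compact_ext {T : Type} (O : (T -> Prop) -> Prop) (A B : T -> Prop) :
  (forall x, A x <-> B x) -> compact_set O A -> compact_set O B.
Proof.
  intros E H I U HU HB.
  destruct (H I U HU) as [l Hl].
  - intros x Hx. apply HB, E, Hx.
  - exists l. intros x Hx. apply Hl, E, Hx.
Qed.

Lemma compact_empty {T : Type} (O : (T -> Prop) -> Prop) (A : T -> Prop) :
  (forall x, ~ A x) -> compact_set O A.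
Proof. intros H I U _ _. exists []. intros x Hx. destruct (H x Hx). Qed.

Lemma compact_union {T : Type} (O : (T -> Prop) -> Prop) (A B : T -> Prop) :
  compact_set O A -> compact_set O B -> compact_set O (fun x => A x \/ B x).
Proof.
  intros HA HB I U HU HC.
  destruct (HA I U HU) as [l Hl]; [intros x Hx; apply HC; auto|].
  destruct (HB I U HU) as [m Hm]; [intros x Hx; apply HC; auto|].
  exists (l ++ m). intros x [Hx|Hx].
  - destruct (Hl x Hx) as [i [Hi Hu]]. exists i. rewrite in_app_iff. auto.
  - destruct (Hm x Hx) as [i [Hi Hu]]. exists i. rewrite in_app_iff. auto.
Qed.

(** Opens are upsets for the specialization order, so one member of a cover that contains [b]
    already contains all of [A]. *)
Lemma compact_least {T : Type} (O : (T -> Prop) -> Prop) (A : T -> Prop) (b : T) :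
  A b -> (forall x, A x -> spec_le O b x) -> compact_set O A.
Proof.
  intros Hb H I U HU HA. destruct (HA b Hb) as [i Hi].
  exists [i]. intros x Hx. exists i. split; [left; reflexivity|].
  exact (H x Hx (U i) (HU i) Hi).
Qed.

Lemma continuous_saturated {T1 T2 : Type} (O1 : (T1 -> Prop) -> Prop)
  (O2 : (T2 -> Prop) -> Prop) (f : T1 -> T2) (K : T2 -> Prop) :
  continuous_map O1 O2 f -> saturated_set O2 K -> saturated_set O1 (fun x => K (f x)).
Proof.
  intros Hf HK x Hx. apply HK. intros U HU HKU.
  apply (Hx (fun x => U (f x))); [exact (Hf U HU)|].
  intros y Hy. exact (HKU _ Hy).
Qed.

Lemma up_open_gt (r : R) : up_open (fun x => r < val x).
Proof.
  split.
  - intros x y; lra.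
  - intros x Hx. exists (val x - r). split; [lra|].
    intros y Hy. apply Rabs_def2 in Hy. lra.
Qed.

Lemma spec_le_I01 (x y : I01) : spec_le up_open x y -> val x <= val y.
Proof.
  intros H. apply Rnot_lt_le. intros Hlt.
  apply (Rlt_irrefl (val y)). exact (H _ (up_open_gt (val y)) Hlt).
Qed.

Lemma spec_le_I01_refl (x : I01) : spec_le up_open x x.
Proof. intros U _ Hx. exact Hx. Qed.

Lemma Icc_compact_saturated (r : R) :
  compact_set up_open (fun x => r <= val x) /\ saturated_set up_open (fun x => r <= val x).
Proof.
  split.
  - destruct (Rle_dec r 1) as [Hr|Hr].
    + apply compact_least with (clampI r).
      * simpl. unfold clamp01, Rmax, Rmin. repeat destruct Rle_dec; lra.
      * intros x Hx U [HU _] Hc. apply (HU _ x Hc). simpl.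
        pose proof (val_range x).
        unfold clamp01, Rmax, Rmin. repeat destruct Rle_dec; lra.
    + apply compact_empty. intros x Hx. pose proof (val_range x). lra.
  - intros x Hx. apply Rnot_lt_le. intros Hlt.
    apply (Rlt_irrefl (val x)).
    apply (Hx _ (up_open_gt (val x))). intros y. lra.
Qed.

(** Compactness forces the infimum [m] of [K] to be attained: otherwise the opens [t < val x] with
    [m < t] cover [K], and a finite subcover yields a lower bound above [m]. *)
Lemma compact_saturated_I01 (K : I01 -> Prop) :
  compact_set up_open K -> saturated_set up_open K ->
  exists r, forall x, K x <-> r <= val x.
Proof.
  intros HC HS.
  destruct (classic (exists x, K x)) as [[x0 Hx0]|HE].
  (* Any number above 1 represents the empty set. *)
  2: { exists 2. intros x. pose proof (val_range x). split; [|lra].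
       intros Hx. destruct HE. exists x. exact Hx. }
  assert (Hup : forall x y, K x -> val x <= val y -> K y).
  { intros x y Hx Hxy. apply HS. intros U [HU _] HKU. exact (HU x y (HKU x Hx) Hxy). }
  destruct (completeness (fun t => forall x, K x -> t <= val x)) as [m [Hub Hlub]].
  { exists (val x0). intros t Ht. exact (Ht x0 Hx0). }
  { exists 0. intros x _. apply val_range. }
  assert (Hm : forall x, K x -> m <= val x).
  { intros x Hx. apply Hlub. intros t Ht. exact (Ht x Hx). }
  assert (Hmin : exists x, K x /\ val x <= m).
  { apply NNPP. intros Hn.
    destruct (HC {t : R | m < t} (fun t x => proj1_sig t < val x)) as [l Hl].
    - intros t. apply up_open_gt.
    - intros x Hx.
      assert (Hmx : m < val x).
      { apply Rnot_le_lt. intros Hle. apply Hn. exists x. auto. }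
      assert (Hmid : m < (m + val x) / 2) by lra.
      exists (exist _ ((m + val x) / 2) Hmid). simpl. lra.
    - assert (Hbelow : exists t, m < t /\ forall i, In i l -> t <= proj1_sig i).
      { clear Hl. induction l as [|i l [t [Ht IH]]].
        - exists (m + 1). split; [lra|intros i []].
        - exists (Rmin (proj1_sig i) t). split.
          + apply Rmin_glb_lt; [apply (proj2_sig i)|exact Ht].
          + intros j [<-|Hj]; [apply Rmin_l|].
            eapply Rle_trans; [apply Rmin_r|apply IH, Hj]. }
      destruct Hbelow as [t [Ht Hb]].
      apply (Rlt_not_le _ _ Ht), Hub. intros x Hx.
      destruct (Hl x Hx) as [i [Hi Hix]]. specialize (Hb i Hi). lra. }
  destruct Hmin as [x1 [Hx1 Hle]].
  exists m. intros x. split; [apply Hm|].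
  intros Hx. apply (Hup x1); [exact Hx1|lra].
Qed.

(** One tolerance serves finitely many coordinates, and since opens are upsets only the drop of a
    coordinate has to be bounded. Openness in powers is handled in this form below. *)
Lemma prod_openP (X : Type) (U : (X -> I01) -> Prop) :
  prod_open X U <->
  forall v, U v -> exists (l : list X) (d : R), 0 < d /\
    forall w, (forall i, In i l -> val (v i) < val (w i) + d) -> U w.
Proof.
  split.
  - intros HU v Hv. destruct (HU v Hv) as [L [HS [HL HLU]]].
    assert (H : exists (l : list X) (d : R), 0 < d /\
      forall w, (forall i, In i l -> val (v i) < val (w i) + d) ->
        forall V, In V L -> V w).
    { clear HLU. induction L as [|V L IH].
      - exists [], 1. split; [lra|]. intros w _ V [].
      - destruct IH as [l [d [Hd IH]]].
        { intros V' HV'. apply HS. right. exact HV'. }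
        { intros V' HV'. apply HL. right. exact HV'. }
        destruct (HS V (or_introl eq_refl)) as [i [W [[HW1 HW2] ->]]].
        pose proof (HL _ (or_introl eq_refl)) as HVv. simpl in HVv.
        destruct (HW2 _ HVv) as [e [He HWe]].
        exists (i :: l), (Rmin d e). split; [apply Rmin_glb_lt; assumption|].
        intros w Hw V [<-|HV].
        + pose proof (Hw i (or_introl eq_refl)) as Hi.
          pose proof (Rmin_r d e).
          destruct (Rle_dec (val (v i)) (val (w i))) as [Hle|Hle].
          * exact (HW1 _ _ HVv Hle).
          * apply HWe. apply Rabs_def1; lra.
        + apply IH; [|exact HV]. intros j Hj.
          pose proof (Hw j (or_intror Hj)). pose proof (Rmin_l d e). lra. }
    destruct H as [l [d [Hd H]]]. exists l, d. split; [exact Hd|].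
    intros w Hw. apply HLU. exact (H w Hw).
  - intros H v Hv. destruct (H v Hv) as [l [d [Hd Hl]]].
    exists (map (fun i (g : X -> I01) => val (v i) - d < val (g i)) l).
    split; [|split].
    + intros V HV. apply in_map_iff in HV. destruct HV as [i [<- _]].
      exists i, (fun x => val (v i) - d < val x). split; [apply up_open_gt|reflexivity].
    + intros V HV. apply in_map_iff in HV. destruct HV as [i [<- _]]. lra.
    + intros w Hw. apply Hl. intros i Hi.
      specialize (Hw _ (in_map (fun i (g : X -> I01) => val (v i) - d < val (g i)) l i Hi)).
      simpl in Hw. lra.
Qed.

Lemma prod_open_union (X : Type) (U V : (X -> I01) -> Prop) :
  prod_open X U -> prod_open X V -> prod_open X (fun v => U v \/ V v).
Proof.
  rewrite !prod_openP. intros HU HV v [Hv|Hv].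
  - destruct (HU v Hv) as [l [d [Hd H]]]. exists l, d. split; [exact Hd|].
    intros w Hw. left. exact (H w Hw).
  - destruct (HV v Hv) as [l [d [Hd H]]]. exists l, d. split; [exact Hd|].
    intros w Hw. right. exact (H w Hw).
Qed.

Lemma prod_open_inter (X : Type) (U V : (X -> I01) -> Prop) :
  prod_open X U -> prod_open X V -> prod_open X (fun v => U v /\ V v).
Proof.
  rewrite !prod_openP. intros HU HV v [Hv1 Hv2].
  destruct (HU v Hv1) as [l [d [Hd H]]].
  destruct (HV v Hv2) as [l' [d' [Hd' H']]].
  exists (l ++ l'), (Rmin d d'). split; [apply Rmin_glb_lt; assumption|].
  pose proof (Rmin_l d d'). pose proof (Rmin_r d d').
  intros w Hw. split; [apply H|apply H']; intros i Hi;
    specialize (Hw i); rewrite in_app_iff in Hw; specialize (Hw ltac:(auto)); lra.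
Qed.

(** The generating sets are stable under finite intersections, because [K] lies in [U] and in [U']
    iff it lies in their intersection; hence they form a base. *)
Lemma VU_open_inv (X : Type) (W : VU (prod_open X) -> Prop) (K : VU (prod_open X)) :
  VU_open (prod_open X) W -> W K ->
  exists U, prod_open X U /\ (forall x, proj1_sig K x -> U x) /\
    forall K' : VU (prod_open X), (forall x, proj1_sig K' x -> U x) -> W K'.
Proof.
  intros HW HK. destruct (HW K HK) as [L [HS [HL HLW]]].
  assert (H : exists U, prod_open X U /\ (forall x, proj1_sig K x -> U x) /\
    forall K' : VU (prod_open X), (forall x, proj1_sig K' x -> U x) ->
      forall V, In V L -> V K').
  { clear HLW. induction L as [|V L IH].
    - exists (fun _ => True). split; [|split; [auto|intros K' _ V []]].
      apply prod_openP. intros v _. exists [], 1. split; [lra|auto].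
    - destruct IH as [U [HU [HKU IH]]].
      { intros V' HV'. apply HS. right. exact HV'. }
      { intros V' HV'. apply HL. right. exact HV'. }
      destruct (HS V (or_introl eq_refl)) as [U' [HU' ->]].
      pose proof (HL _ (or_introl eq_refl)) as HVK. simpl in HVK.
      exists (fun v => U v /\ U' v). split; [|split].
      + apply prod_open_inter; assumption.
      + auto.
      + intros K' HK' V [<-|HV].
        * intros x Hx. apply HK', Hx.
        * apply IH; [|exact HV]. intros x Hx. apply HK', Hx. }
  destruct H as [U [HU [HKU H]]]. exists U. split; [exact HU|split; [exact HKU|]].
  intros K' HK'. apply HLW. exact (H K' HK').
Qed.

(** * Perfect real-valued functions and Urysohn functions *)

(** Perfection tested on rays only. Real values allow maxima to be formed without clamping. *)
Definition perfect_real (X : Type) (h : (X -> I01) -> R) : Prop :=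
  (forall r, prod_open X (fun v => r < h v)) /\
  (forall r, compact_set (prod_open X) (fun v => r <= h v)).

(** Rays suffice: each compact saturated subset of the interval is a closed ray by
    [compact_saturated_I01], and saturation of preimages follows from continuity. *)
Lemma perfect_real_map (X : Type) (h : (X -> I01) -> I01) :
  perfect_real X (fun v => val (h v)) -> perfect_map (prod_open X) up_open h.
Proof.
  intros [Ho Hc].
  assert (Hcont : continuous_map (prod_open X) up_open h).
  { intros U [HU1 HU2]. apply prod_openP. intros v Hv.
    destruct (HU2 _ Hv) as [e [He HUe]].
    destruct (proj1 (prod_openP _ _) (Ho (val (h v) - e)) v) as [l [d [Hd H]]]; [lra|].
    exists l, d. split; [exact Hd|]. intros w Hw. specialize (H w Hw). simpl in H.
    destruct (Rle_dec (val (h v)) (val (h w))) as [Hle|Hle].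
    - exact (HU1 _ _ Hv Hle).
    - apply HUe. apply Rabs_def1; lra. }
  split; [exact Hcont|]. intros K HKc HKs. split.
  - destruct (compact_saturated_I01 K HKc HKs) as [r Hr].
    apply (compact_ext _ (fun v => r <= val (h v))); [|apply Hc].
    intros v. symmetry. apply Hr.
  - apply (continuous_saturated _ up_open); assumption.
Qed.

(** Superlevel sets of a maximum are unions of superlevel sets, and binary unions preserve openness
    and compactness. *)
Lemma perfect_real_max (X : Type) (h1 h2 : (X -> I01) -> R) :
  perfect_real X h1 -> perfect_real X h2 ->
  perfect_real X (fun v => Rmax (h1 v) (h2 v)).
Proof.
  intros [Ho1 Hc1] [Ho2 Hc2]. split; intros r.
  - pose proof (prod_open_union _ _ _ (Ho1 r) (Ho2 r)) as H.
    apply prod_openP. intros v Hv.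
    destruct (proj1 (prod_openP _ _) H v) as [l [d [Hd Hw]]].
    { unfold Rmax in Hv. destruct Rle_dec; auto. }
    exists l, d. split; [exact Hd|]. intros w Hlw. destruct (Hw w Hlw).
    + eapply Rlt_le_trans; [eassumption|apply Rmax_l].
    + eapply Rlt_le_trans; [eassumption|apply Rmax_r].
  - apply (compact_ext _ (fun v => r <= h1 v \/ r <= h2 v)).
    + intros v. unfold Rmax. destruct Rle_dec; split; lra.
    + apply compact_union; auto.
Qed.

(* The set is empty or a principal upset, so that no form of Tychonoff's theorem is needed. *)
Lemma cylinder_compact (X : Type) (l : list X) (a : X -> R) :
  compact_set (prod_open X) (fun v => forall i, In i l -> a i <= val (v i)).
Proof.
  destruct (classic (exists v : X -> I01, forall i, In i l -> a i <= val (v i)))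
    as [[v0 Hv0]|HE].
  2: { apply compact_empty. intros v Hv. apply HE. exists v. exact Hv. }
  (* The least element is [a i], raised to 0 if negative, on [l], and 0 elsewhere; [v0] witnesses
     [a i <= 1] on [l]. *)
  apply compact_least with
    (fun i => if excluded_middle_informative (In i l) then clampI (a i) else clampI 0).
  - intros i Hi. destruct excluded_middle_informative; [|contradiction].
    specialize (Hv0 i Hi). pose proof (val_range (v0 i)). simpl.
    unfold clamp01, Rmax, Rmin. repeat destruct Rle_dec; lra.
  - intros v Hv U HU Hb. rewrite prod_openP in HU.
    destruct (HU _ Hb) as [m [d [Hd H]]]. apply H. intros i _.
    pose proof (val_range (v i)).
    destruct excluded_middle_informative as [Hi|Hi].
    + specialize (Hv i Hi). simpl.
      unfold clamp01, Rmax, Rmin. repeat destruct Rle_dec; lra.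
    + simpl. rewrite clamp01_id; lra.
Qed.

(* Equals 1 where [x i <= v i + e/2] for all [i] in [l],
   and 0 where [v i + e <= x i] for some [i] in [l]. *)
Fixpoint bump {X : Type} (x : X -> I01) (e : R) (l : list X) (v : X -> I01) : R :=
  match l with
  | [] => 1
  | i :: l => Rmin (clamp01 ((val (v i) - val (x i) + e) * (2 / e))) (bump x e l v)
  end.

(** At heights in (0,1] the clamp is invisible, so superlevel sets of [bump] are cylinders; openness
    and compactness are both read off from this. *)
Lemma bump_ge {X : Type} (x : X -> I01) (e r : R) (l : list X) (v : X -> I01) :
  0 < e -> 0 < r <= 1 ->
  (r <= bump x e l v <-> forall i, In i l -> val (x i) - e + r * (e / 2) <= val (v i)).
Proof.
  intros He Hr. induction l as [|j l IH]; simpl.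
  - split; [intros _ i []|lra].
  - assert (Hj : r <= clamp01 ((val (v j) - val (x j) + e) * (2 / e)) <->
      val (x j) - e + r * (e / 2) <= val (v j)).
    { rewrite clamp01_ge by exact Hr.
      replace r with (r * (e / 2) * (2 / e)) at 1 by (field; lra).
      assert (0 < 2 / e) by (apply Rdiv_lt_0_compat; lra).
      split; intros H0.
      - apply Rmult_le_reg_r in H0; lra.
      - apply Rmult_le_compat_r; lra. }
    split.
    + intros H i [<-|Hi].
      * apply Hj. eapply Rle_trans; [exact H|apply Rmin_l].
      * apply IH; [|exact Hi]. eapply Rle_trans; [exact H|apply Rmin_r].
    + intros H. apply Rmin_glb; [apply Hj|apply IH]; auto.
Qed.

Lemma bump_range {X : Type} (x : X -> I01) (e : R) (l : list X) (v : X -> I01) :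
  0 <= bump x e l v <= 1.
Proof.
  induction l as [|i l IH]; simpl; [lra|].
  match goal with |- 0 <= Rmin (clamp01 ?t) _ <= _ => pose proof (clamp01_in t) end.
  unfold Rmin. destruct Rle_dec; lra.
Qed.

Lemma bump_perfect {X : Type} (x : X -> I01) (e : R) (l : list X) :
  0 < e -> perfect_real X (bump x e l).
Proof.
  intros He. split; intros r.
  - apply prod_openP. intros v Hv.
    set (t := bump x e l v) in *.
    (* Lowering the height from [t] to [(r + t) / 2], still above [r], moves the cylinder bounds
       down by exactly this amount. *)
    exists l, ((t - r) / 2 * (e / 2)). split.
    + apply Rmult_lt_0_compat; lra.
    + intros w Hw. pose proof (bump_range x e l w).
      destruct (Rlt_le_dec r 0) as [Hr|Hr]; [lra|].
      apply Rlt_le_trans with ((r + t) / 2); [lra|].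
      pose proof (bump_range x e l v) as Ht. fold t in Ht.
      apply bump_ge; [exact He|lra|]. intros i Hi.
      assert (Hv' : t <= bump x e l v) by (unfold t; lra).
      rewrite bump_ge in Hv' by lra.
      specialize (Hv' i Hi). specialize (Hw i Hi). nra.
  - destruct (Rle_dec r 0) as [Hr|Hr]; [|destruct (Rle_dec r 1) as [Hr1|Hr1]].
    + apply (compact_ext _ (fun v : X -> I01 => forall i : X, In i [] -> 0 <= val (v i))).
      * intros v. pose proof (bump_range x e l v). split; [lra|intros _ i []].
      * apply (cylinder_compact X [] (fun _ => 0)).
    + apply (compact_ext _ (fun v : X -> I01 =>
        forall i, In i l -> val (x i) - e + r * (e / 2) <= val (v i))).
      * intros v. symmetry. apply bump_ge; lra.
      * apply (cylinder_compact X l (fun i => val (x i) - e + r * (e / 2))).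
    + apply compact_empty. intros v Hv. pose proof (bump_range x e l v). lra.
Qed.

Lemma perfect_real_zero (X : Type) : perfect_real X (fun _ => 0).
Proof.
  split; intros r.
  - apply prod_openP. intros v Hv. exists [], 1. split; [lra|auto].
  - destruct (Rle_dec r 0) as [Hr|Hr].
    + apply (compact_ext _ (fun v : X -> I01 => forall i : X, In i [] -> 0 <= val (v i))).
      * intros v. split; [auto|intros _ i []].
      * apply (cylinder_compact X [] (fun _ => 0)).
    + apply compact_empty. auto.
Qed.

Lemma perfect_real_clampI (X : Type) (h : (X -> I01) -> R) :
  (forall v, 0 <= h v <= 1) -> perfect_real X h ->
  perfect_map (prod_open X) up_open (fun v => clampI (h v)).
Proof.
  intros Hr [Ho Hc]. apply perfect_real_map. split; intros r; simpl.
  - apply prod_openP. intros v. rewrite clamp01_id by apply Hr. intros Hv.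
    destruct (proj1 (prod_openP _ _) (Ho r) v Hv) as [l [d [Hd H]]].
    exists l, d. split; [exact Hd|]. intros w Hw. rewrite clamp01_id by apply Hr.
    exact (H w Hw).
  - apply (compact_ext _ (fun v => r <= h v)); [|apply Hc].
    intros v. rewrite clamp01_id by apply Hr. reflexivity.
Qed.

(** Each point of [K] has a bump function supported in [U]; compactness selects finitely many, and
    their maximum is taken. The open set [V] is kept because the compact sets included in [V] form
    an open neighbourhood of [K] on which the infimum of [h] is 1. *)
Lemma urysohn (X : Type) (K U : (X -> I01) -> Prop) :
  compact_set (prod_open X) K -> prod_open X U -> (forall x, K x -> U x) ->
  exists (V : (X -> I01) -> Prop) (h : (X -> I01) -> I01),
    prod_open X V /\ perfect_map (prod_open X) up_open h /\
    (forall x, K x -> V x) /\ (forall x, V x -> 1 <= val (h x)) /\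
    (forall x, 0 < val (h x) -> U x).
Proof.
  intros HK HU HKU.
  set (ok := fun p : ((X -> I01) -> Prop) * ((X -> I01) -> R) =>
    prod_open X (fst p) /\ perfect_real X (snd p) /\
    (forall x, 0 <= snd p x <= 1) /\
    (forall x, fst p x -> 1 <= snd p x) /\ (forall x, 0 < snd p x -> U x)).
  destruct (HK {p | ok p} (fun p => fst (proj1_sig p))) as [L HL].
  { intros p. apply (proj2_sig p). }
  { intros x Hx. rewrite prod_openP in HU.
    destruct (HU x (HKU x Hx)) as [l [e [He Hl]]].
    (* The bump at half the radius exceeds 1/2 only where no coordinate in [l] drops by [e / 2] or
       more, and there the bump of radius [e] equals 1. *)
    assert (Hok : ok (fun v => 1 / 2 < bump x (e / 2) l v, bump x e l)).
    { repeat split; simpl.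
      - apply bump_perfect. lra.
      - apply bump_perfect. exact He.
      - apply bump_perfect. exact He.
      - apply bump_range.
      - apply bump_range.
      - intros v Hv. apply Rlt_le in Hv. rewrite bump_ge in Hv by lra.
        apply bump_ge; [exact He|lra|]. intros i Hi. specialize (Hv i Hi). lra.
      - intros v Hv. apply Hl. intros i Hi.
        pose proof (bump_range x e l v) as Hr.
        pose proof (proj1 (bump_ge x e _ l v He (conj Hv (proj2 Hr))) (Rle_refl _) i Hi).
        nra. }
    exists (exist _ _ Hok). simpl. apply Rlt_le_trans with 1; [lra|].
    apply bump_ge; [lra|lra|]. intros i _. lra. }
  assert (H : exists p, ok p /\ forall q, In q L -> forall x, fst (proj1_sig q) x -> fst p x).
  { clear HL. induction L as [|[q Hq] L [p [Hp IH]]].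
    - exists (fun _ => False, fun _ => 0). split; [|intros q []].
      split; [intros x []|]. split; [apply perfect_real_zero|].
      simpl. repeat split; intros; (lra || contradiction).
    - exists (fun v => fst q v \/ fst p v, fun v => Rmax (snd q v) (snd p v)).
      destruct Hq as [Q1 [Q2 [Q3 [Q4 Q5]]]], Hp as [P1 [P2 [P3 [P4 P5]]]].
      split.
      + split; [apply prod_open_union; assumption|].
        split; [apply perfect_real_max; assumption|]. simpl. split; [|split].
        * intros x. specialize (Q3 x). specialize (P3 x).
          unfold Rmax. destruct Rle_dec; lra.
        * intros x [Hx|Hx].
          -- eapply Rle_trans; [apply Q4, Hx|apply Rmax_l].
          -- eapply Rle_trans; [apply P4, Hx|apply Rmax_r].
        * intros x. unfold Rmax. destruct Rle_dec; auto.
      + intros q' [<-|Hq'] x Hx; simpl in *; [auto|right; eapply IH; eassumption]. }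
  destruct H as [[V h] [[P1 [P2 [P3 [P4 P5]]]] HV]]. simpl in *.
  exists V, (fun v => clampI (h v)). repeat split.
  - exact P1.
  - apply perfect_real_clampI; assumption.
  - apply perfect_real_clampI; assumption.
  - apply perfect_real_clampI; assumption.
  - intros x Hx. destruct (HL x Hx) as [q [Hq Hqx]]. exact (HV q Hq x Hqx).
  - intros x Hx. simpl. rewrite clamp01_id by apply P3. auto.
  - intros x. simpl. rewrite clamp01_id by apply P3. auto.
Qed.

(** * Approximation by boxes *)

(** Up-closure does not change an infimum, so this is the infimum of [h] over [K], with value 1 for
    empty [K]. *)
Definition inf_on {X : Type} (h : (X -> I01) -> I01) (K : (X -> I01) -> Prop) : R :=
  val (box (Vup_map up_open h K)).

Lemma inf_on_le {X : Type} (h : (X -> I01) -> I01) (K : (X -> I01) -> Prop) (x : X -> I01) :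
  K x -> inf_on h K <= val (h x).
Proof.
  intros Hx. unfold inf_on, box, inf01_R. simpl.
  destruct (Glb_Rbar_correct (fun r => exists a : I01, Vup_map up_open h K a /\ val a = r))
    as [Hlb Hglb].
  assert (H1 : Rbar_le (Glb_Rbar (fun r => exists a : I01, Vup_map up_open h K a /\ val a = r))
    (val (h x))).
  { apply Hlb. exists (h x). split; [|reflexivity].
    exists (h x). split; [exists x; auto|apply spec_le_I01_refl]. }
  assert (H2 : Rbar_le 0
    (Glb_Rbar (fun r => exists a : I01, Vup_map up_open h K a /\ val a = r))).
  { apply Hglb. intros r [a [_ <-]]. apply val_range. }
  pose proof (val_range (h x)).
  destruct Glb_Rbar as [g| |]; simpl in *; try contradiction.
  rewrite clamp01_id; lra.
Qed.

Lemma inf_on_ge {X : Type} (h : (X -> I01) -> I01) (K : (X -> I01) -> Prop) (r : R) :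
  r <= 1 -> (forall x, K x -> r <= val (h x)) -> r <= inf_on h K.
Proof.
  intros Hr H. unfold inf_on, box, inf01_R. simpl.
  destruct (Glb_Rbar_correct (fun r => exists a : I01, Vup_map up_open h K a /\ val a = r))
    as [Hlb Hglb].
  assert (H1 : Rbar_le r
    (Glb_Rbar (fun r => exists a : I01, Vup_map up_open h K a /\ val a = r))).
  { apply Hglb. intros t [a [[b [[x [Hx <-]] Hle]] <-]].
    apply spec_le_I01 in Hle. specialize (H x Hx). simpl. lra. }
  (* The value [p_infty] arises from an empty [K], where the box is 1; hence the bound [r <= 1]. *)
  destruct Glb_Rbar as [g| |]; simpl in *; try contradiction;
    unfold clamp01, Rmax, Rmin; repeat destruct Rle_dec; lra.
Qed.

Lemma inf_on_range {X : Type} (h : (X -> I01) -> I01) (K : (X -> I01) -> Prop) :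
  0 <= inf_on h K <= 1.
Proof. apply val_range. Qed.

Lemma level_approximation (X : Type) (f : VU (prod_open X) -> I01) (c e : R) :
  perfect_map (VU_open (prod_open X)) up_open f -> 0 < e ->
  exists L : list ((X -> I01) -> I01),
    (forall h, In h L -> perfect_map (prod_open X) up_open h /\
       forall K, 0 < inf_on h (proj1_sig K) -> c - e < val (f K)) /\
    (forall K, c <= val (f K) -> exists h, In h L /\ 1 <= inf_on h (proj1_sig K)).
Proof.
  intros [Hcont Hperf] He.
  destruct (Icc_compact_saturated c) as [Hc1 Hc2].
  destruct (Hperf _ Hc1 Hc2) as [HC _].
  set (ok := fun p : ((X -> I01) -> Prop) * ((X -> I01) -> I01) =>
    prod_open X (fst p) /\ perfect_map (prod_open X) up_open (snd p) /\
    (forall x, fst p x -> 1 <= val (snd p x)) /\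
    forall K, 0 < inf_on (snd p) (proj1_sig K) -> c - e < val (f K)).
  destruct (HC {p | ok p}
    (fun p K => forall x, proj1_sig K x -> fst (proj1_sig p) x)) as [L HL].
  - intros [p Hp] K HK. simpl in *.
    exists [fun K : VU (prod_open X) => forall x, proj1_sig K x -> fst p x].
    split; [|split].
    + intros V [<-|[]]. exists (fst p). split; [apply Hp|reflexivity].
    + intros V [<-|[]]. exact HK.
    + intros K' HK'. exact (HK' _ (or_introl eq_refl)).
  - intros K HK.
    destruct (VU_open_inv X _ K (Hcont _ (up_open_gt (c - e)))) as [U [HU [HKU HUf]]].
    { lra. }
    destruct (urysohn X (proj1_sig K) U) as [V [h [HV [Hh [HKV [HVh HhU]]]]]];
      [apply (proj2_sig K)|exact HU|exact HKU|].
    assert (Hok : ok (V, h)).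
    { split; [exact HV|split; [exact Hh|split; [exact HVh|]]]. simpl.
      (* A positive infimum makes [h] positive on all of [K'], which therefore lies in [U]. *)
      intros K' HK'. apply HUf. intros x Hx. apply HhU.
      eapply Rlt_le_trans; [exact HK'|apply inf_on_le, Hx]. }
    exists (exist _ _ Hok). exact HKV.
  - exists (map (fun p => snd (proj1_sig p)) L). split.
    + intros h Hh. apply in_map_iff in Hh. destruct Hh as [[p Hp] [<- _]].
      split; apply Hp.
    + intros K HK. destruct (HL K HK) as [p [Hp HKp]].
      exists (snd (proj1_sig p)). split; [exact (in_map (fun p => snd (proj1_sig p)) L p Hp)|].
      apply inf_on_ge; [lra|]. intros x Hx. apply (proj2_sig p). auto.
Qed.

(** The grid consists of the multiples of [e] in [0,1]. Once [INR n * e] exceeds 1, every [t] is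
    already served by the earlier points. *)
Lemma grid (e : R) : 0 < e ->
  exists l : list R, (forall c, In c l -> 0 <= c <= 1) /\
    forall t, 0 <= t <= 1 -> exists c, In c l /\ t - e <= c <= t.
Proof.
  intros He.
  assert (H : forall n : nat, exists l : list R, (forall c, In c l -> 0 <= c <= 1) /\
    forall t, 0 <= t <= 1 -> t < INR n * e -> exists c, In c l /\ t - e <= c <= t).
  { induction n as [|n [l [Hl IH]]].
    - exists []. split; [intros c []|]. intros t Ht. simpl. lra.
    - rewrite S_INR. destruct (Rle_dec (INR n * e) 1) as [Hn|Hn].
      + exists (INR n * e :: l). split.
        * intros c [<-|Hc]; [|auto]. pose proof (pos_INR n). nra.
        * intros t Ht Htn. destruct (Rlt_dec t (INR n * e)) as [H|H].
          -- destruct (IH t Ht H) as [c [Hc Hct]]. exists c. split; [right|]; assumption.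
          -- exists (INR n * e). split; [left; reflexivity|lra].
      + exists l. split; [exact Hl|]. intros t Ht _. apply IH; lra. }
  destruct (INR_archimed e 1 He) as [n Hn].
  destruct (H n) as [l [Hl Hl']]. exists l. split; [exact Hl|].
  intros t Ht. apply Hl'; lra.
Qed.

(* The coefficients [fst p] cannot be absorbed into the functions [snd p]:
   the infimum over the empty set is 1 for every function. *)
Lemma approximation (X : Type) (f : VU (prod_open X) -> I01) (e : R) :
  perfect_map (VU_open (prod_open X)) up_open f -> 0 < e ->
  exists L : list (R * ((X -> I01) -> I01)),
    (forall p, In p L -> 0 <= fst p <= 1 /\ perfect_map (prod_open X) up_open (snd p) /\
       forall K, fst p * inf_on (snd p) (proj1_sig K) <= val (f K) + e) /\
    (forall K, exists p, In p L /\ val (f K) - e <= fst p * inf_on (snd p) (proj1_sig K)).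
Proof.
  intros Hf He. destruct (grid e He) as [l [Hl Hgrid]].
  assert (H : exists L : list (R * ((X -> I01) -> I01)),
    (forall p, In p L -> 0 <= fst p <= 1 /\ perfect_map (prod_open X) up_open (snd p) /\
       forall K, fst p * inf_on (snd p) (proj1_sig K) <= val (f K) + e) /\
    (forall c K, In c l -> c <= val (f K) ->
       exists p, In p L /\ c <= fst p * inf_on (snd p) (proj1_sig K))).
  { clear Hgrid. induction l as [|c l IH].
    - exists []. split; [intros p []|intros c K []].
    - destruct IH as [L [HL1 HL2]]; [intros; apply Hl; right; assumption|].
      destruct (level_approximation X f c e Hf He) as [M [HM1 HM2]].
      pose proof (Hl c (or_introl eq_refl)) as Hc.
      exists (map (pair c) M ++ L). split.
      + intros p Hp. apply in_app_iff in Hp. destruct Hp as [Hp|Hp]; [|auto].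
        apply in_map_iff in Hp. destruct Hp as [h [<- Hh]]. simpl.
        destruct (HM1 h Hh) as [Hper Hlow].
        split; [exact Hc|split; [exact Hper|]]. intros K.
        pose proof (inf_on_range h (proj1_sig K)) as Hr. pose proof (val_range (f K)).
        (* With infimum 0 the term vanishes; otherwise it is at most [c], which is below
           [val (f K) + e]. *)
        destruct (Rlt_dec 0 (inf_on h (proj1_sig K))) as [H0|H0].
        * specialize (Hlow K H0). nra.
        * nra.
      + intros c' K [<-|Hc'] HcK.
        * destruct (HM2 K HcK) as [h [Hh H1]]. exists (c, h). split.
          -- apply in_app_iff. left. apply in_map. exact Hh.
          -- simpl. nra.
        * destruct (HL2 c' K Hc' HcK) as [p [Hp Hcp]]. exists p. split; [|exact Hcp].
          apply in_app_iff. right. exact Hp. }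
  destruct H as [L [HL1 HL2]]. exists L. split; [exact HL1|].
  intros K. destruct (Hgrid (val (f K)) (val_range _)) as [c [Hc Hcf]].
  destruct (HL2 c K Hc) as [p [Hp Hcp]]; [lra|].
  exists p. split; [exact Hp|lra].
Qed.

(** * Compactness in a countable power *)

Definition update (v : nat -> I01) (n : nat) (a : I01) : nat -> I01 :=
  fun i => if Nat.eq_dec i n then a else v i.

Section Ideal.

(** An ideal of sets, later instantiated by the sets that finitely many members of a given cover
    suffice to cover. *)
Variable small : ((nat -> I01) -> Prop) -> Prop.
Hypothesis small_sub : forall A B : (nat -> I01) -> Prop,
  (forall v, A v -> B v) -> small B -> small A.
Hypothesis small_union : forall A B : (nat -> I01) -> Prop,
  small A -> small B -> small (fun v => A v \/ B v).
Hypothesis small_empty : small (fun _ => False).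

(** Heine-Borel by suprema: [m] is the supremum of the [a] for which the part of some [Q e] with
    coordinate [n] below [a] is small. If the part near [m] were small too, then either [m + e]
    would belong to [E], or [m + e] would exceed 1 and a whole [Q] would be small. *)
Lemma cluster_coordinate (Q : R -> (nat -> I01) -> Prop) (n : nat) :
  (forall d e v, d <= e -> Q d v -> Q e v) ->
  (forall e, 0 < e -> ~ small (Q e)) ->
  exists a : I01, forall e, 0 < e ->
    ~ small (fun v => Q e v /\ Rabs (val (v n) - val a) < e).
Proof.
  intros Qmono HQ.
  set (E := fun a => 0 <= a <= 1 /\
    exists e, 0 < e /\ small (fun v => Q e v /\ val (v n) < a)).
  assert (E0 : E 0).
  { split; [lra|]. exists 1. split; [lra|].
    refine (small_sub _ _ _ small_empty). intros v [_ Hv].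
    pose proof (val_range (v n)). lra. }
  destruct (completeness E) as [m [Hub Hlub]].
  { exists 1. intros a [Ha _]. lra. }
  { exists 0. exact E0. }
  assert (Hm : 0 <= m <= 1).
  { split; [exact (Hub 0 E0)|]. apply Hlub. intros a [Ha _]. lra. }
  exists (exist _ m Hm). simpl. intros e He Hs.
  assert (Ha : exists a, E a /\ m - e < a).
  { apply NNPP. intros Hn.
    assert (m <= m - e); [|lra]. apply Hlub. intros a HEa.
    apply Rnot_lt_le. intros Hlt. apply Hn. exists a. auto. }
  destruct Ha as [a [[_ [d [Hd Hsa]]] Hma]].
  assert (Hk : 0 < Rmin d e) by (apply Rmin_glb_lt; assumption).
  assert (Hs' : small (fun v => Q (Rmin d e) v /\ val (v n) < m + e)).
  { refine (small_sub _ _ _ (small_union _ _ Hsa Hs)). intros v [Hv Hvn].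
    destruct (Rlt_dec (val (v n)) a) as [H|H].
    - left. split; [|exact H]. exact (Qmono _ _ _ (Rmin_l _ _) Hv).
    - right. split; [exact (Qmono _ _ _ (Rmin_r _ _) Hv)|]. apply Rabs_def1; lra. }
  destruct (Rle_dec (m + e) 1) as [H1|H1].
  - assert (m + e <= m); [|lra]. apply Hub. split; [lra|]. exists (Rmin d e). auto.
  - apply (HQ _ Hk). refine (small_sub _ _ _ Hs').
    intros v Hv. split; [exact Hv|]. pose proof (val_range (v n)). lra.
Qed.

(** Coordinates are chosen successively under the invariant [P n], which restricts the first [n] of
    them. A neighbourhood involves finitely many coordinates, hence only an initial segment. *)
Lemma cluster_point (C : (nat -> I01) -> Prop) :
  ~ small C ->
  exists a : nat -> I01, forall (l : list nat) e, 0 < e ->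
    ~ small (fun v => C v /\ forall i, In i l -> Rabs (val (v i) - val (a i)) < e).
Proof.
  intros HC.
  set (P := fun n (a : nat -> I01) => forall e, 0 < e ->
    ~ small (fun v => C v /\ forall i, (i < n)%nat -> Rabs (val (v i) - val (a i)) < e)).
  (* The implication stands inside the existential so that the choice function [step] is total. *)
  assert (Hstep : forall n a, exists b, P n a -> P (S n) (update a n b)).
  { intros n a. destruct (classic (P n a)) as [HP|HP].
    2: { exists (a n). intros H. contradiction. }
    destruct (cluster_coordinate
      (fun e v => C v /\ forall i, (i < n)%nat -> Rabs (val (v i) - val (a i)) < e) n)
      as [b Hb].
    - intros d e v Hde [Hv Hi]. split; [exact Hv|]. intros i Hin.
      specialize (Hi i Hin). lra.
    - exact HP.
    - exists b. intros _ e He Hs. apply (Hb e He). refine (small_sub _ _ _ Hs).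
      intros v [[Hv Hi] Hn]. split; [exact Hv|]. intros i Hin.
      unfold update. destruct Nat.eq_dec as [->|Hne]; [exact Hn|]. apply Hi. lia. }
  set (step := fun n a => proj1_sig (constructive_indefinite_description _ (Hstep n a))).
  assert (Hstep' : forall n a, P n a -> P (S n) (update a n (step n a))).
  { intros n a. exact (proj2_sig (constructive_indefinite_description _ (Hstep n a))). }
  set (seqn := fix seqn n := match n with
    | O => fun _ => clampI 0
    | S n => update (seqn n) n (step n (seqn n))
    end).
  assert (HP : forall n, P n (seqn n)).
  { induction n as [|n IH].
    - intros e He Hs. apply HC. refine (small_sub _ _ _ Hs).
      intros v Hv. split; [exact Hv|]. intros i Hi. lia.
    - exact (Hstep' n _ IH). }
  (* Coordinate [i] is set at stage [S i] and never changed later, so the diagonal agrees with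
     [seqn n] below [n]. *)
  assert (Hstable : forall i n, (i < n)%nat -> seqn n i = seqn (S i) i).
  { intros i n Hin. induction Hin as [|n Hin IH]; [reflexivity|].
    rewrite <- IH. change (update (seqn n) n (step n (seqn n)) i = seqn n i).
    unfold update. destruct Nat.eq_dec; [lia|reflexivity]. }
  exists (fun i => seqn (S i) i). intros l e He Hs.
  apply (HP (S (list_max l)) e He). refine (small_sub _ _ _ Hs).
  intros v [Hv Hi]. split; [exact Hv|]. intros i Hil.
  rewrite <- (Hstable i (S (list_max l))).
  - apply Hi. pose proof (proj1 (list_max_le l (list_max l)) (le_n _)) as Hmax.
    rewrite Forall_forall in Hmax. specialize (Hmax i Hil). lia.
  - pose proof (proj1 (list_max_le l (list_max l)) (le_n _)) as Hmax.
    rewrite Forall_forall in Hmax. specialize (Hmax i Hil). lia.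
Qed.

End Ideal.

(* Uniform continuity and monotonicity at once. *)
Definition ord_uniform (phi : (nat -> I01) -> R) : Prop :=
  forall e, 0 < e -> exists (l : list nat) (d : R), 0 < d /\
    forall v w, (forall i, In i l -> val (v i) < val (w i) + d) -> phi v < phi w + e.

(** Without a finite subcover there is a cluster point [a] relative to the ideal of finitely covered
    sets. Uniformity puts [a] in the superlevel set, and the member of the cover that contains [a]
    then covers a whole neighbourhood, a contradiction. *)
Lemma ord_uniform_compact (phi : (nat -> I01) -> R) (r : R) :
  ord_uniform phi -> compact_set (prod_open nat) (fun v => r <= phi v).
Proof.
  intros Hphi I U HU Hcov. apply NNPP. intros Hn.
  destruct (cluster_point
    (fun A => exists l : list I, forall v, A v -> exists i, In i l /\ U i v))
    with (C := fun v => r <= phi v) as [a Ha].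
  - intros A B HAB [l Hl]. exists l. intros v Hv. apply Hl, HAB, Hv.
  - intros A B [l Hl] [m Hm]. exists (l ++ m). intros v [Hv|Hv].
    + destruct (Hl v Hv) as [i [Hi Hu]]. exists i. rewrite in_app_iff. auto.
    + destruct (Hm v Hv) as [i [Hi Hu]]. exists i. rewrite in_app_iff. auto.
  - exists []. intros v [].
  - exact Hn.
  - assert (Hra : r <= phi a).
    { apply Rnot_lt_le. intros Hlt.
      destruct (Hphi (r - phi a)) as [l [d [Hd H]]]; [lra|].
      apply (Ha l d Hd). exists []. intros v [Hrv Hv]. exfalso.
      assert (phi v < phi a + (r - phi a)); [|lra].
      apply H. intros i Hi. specialize (Hv i Hi). apply Rabs_def2 in Hv. lra. }
    destruct (Hcov a Hra) as [i Hi].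
    pose proof (HU i) as HUi. rewrite prod_openP in HUi.
    destruct (HUi a Hi) as [l [d [Hd H]]].
    apply (Ha l d Hd). exists [i]. intros v [_ Hv]. exists i.
    split; [left; reflexivity|]. apply H. intros j Hj.
    specialize (Hv j Hj). apply Rabs_def2 in Hv. lra.
Qed.

Lemma ord_uniform_perfect (phi : (nat -> I01) -> R) :
  ord_uniform phi ->
  perfect_map (prod_open nat) up_open (fun v => clampI (phi v)).
Proof.
  intros Hphi.
  assert (Hc : ord_uniform (fun v => clamp01 (phi v))).
  { intros e He. destruct (Hphi e He) as [l [d [Hd H]]].
    exists l, d. split; [exact Hd|]. intros v w Hvw. apply clamp01_lt; auto. }
  apply perfect_real_map. split; intros r; simpl.
  - apply prod_openP. intros v Hv.
    destruct (Hc (clamp01 (phi v) - r)) as [l [d [Hd H]]]; [lra|].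
    exists l, d. split; [exact Hd|]. intros w Hw. specialize (H v w Hw). simpl in H. lra.
  - apply ord_uniform_compact. exact Hc.
Qed.

Lemma ord_uniform_const (c : R) : ord_uniform (fun _ => c).
Proof. intros e He. exists [], 1. split; [lra|]. intros; lra. Qed.

Lemma ord_uniform_scale (c : R) (i : nat) :
  0 <= c <= 1 -> ord_uniform (fun v => c * val (v i)).
Proof.
  intros Hc e He. exists [i], e. split; [exact He|].
  intros v w H. specialize (H i (or_introl eq_refl)). destruct (Rle_dec (val (v i)) (val (w i))); nra.
Qed.

Lemma ord_uniform_shift (phi : (nat -> I01) -> R) (c : R) :
  ord_uniform phi -> ord_uniform (fun v => phi v + c).
Proof.
  intros H e He. destruct (H e He) as [l [d [Hd Hl]]].
  exists l, d. split; [exact Hd|]. intros v w Hvw. specialize (Hl v w Hvw). lra.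
Qed.

(** The condition on [op] expresses monotonicity and nonexpansiveness for the sup norm at once. *)
Lemma ord_uniform_lattice (op : R -> R -> R) (phi psi : (nat -> I01) -> R) :
  (forall a b a' b' e, a < a' + e -> b < b' + e -> op a b < op a' b' + e) ->
  ord_uniform phi -> ord_uniform psi -> ord_uniform (fun v => op (phi v) (psi v)).
Proof.
  intros Hop H H' e He.
  destruct (H e He) as [l [d [Hd Hl]]], (H' e He) as [l' [d' [Hd' Hl']]].
  exists (l ++ l'), (Rmin d d'). split; [apply Rmin_glb_lt; assumption|].
  pose proof (Rmin_l d d'). pose proof (Rmin_r d d').
  intros v w Hvw. apply Hop; [apply Hl|apply Hl']; intros i Hi;
    specialize (Hvw i); rewrite in_app_iff in Hvw; specialize (Hvw ltac:(auto)); lra.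
Qed.

Lemma ord_uniform_max (phi psi : (nat -> I01) -> R) :
  ord_uniform phi -> ord_uniform psi -> ord_uniform (fun v => Rmax (phi v) (psi v)).
Proof.
  apply ord_uniform_lattice. intros. unfold Rmax. repeat destruct Rle_dec; lra.
Qed.

Lemma ord_uniform_min (phi psi : (nat -> I01) -> R) :
  ord_uniform phi -> ord_uniform psi -> ord_uniform (fun v => Rmin (phi v) (psi v)).
Proof.
  apply ord_uniform_lattice. intros. unfold Rmin. repeat destruct Rle_dec; lra.
Qed.

(** * Uniform limits of clamped sequences *)

(** The next term is the point nearest to [F (S n)] within [(1 / 2) ^ n] of the current one. Maxima,
    minima and shifts by constants preserve [ord_uniform]. *)
Fixpoint clamped (F : nat -> R) (n : nat) : R :=
  match n with
  | O => F O
  | S n => Rmax (clamped F n + - (1 / 2) ^ n) (Rmin (clamped F n + (1 / 2) ^ n) (F (S n)))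
  end.

Lemma half_pow_pos (n : nat) : 0 < (1 / 2) ^ n.
Proof. apply pow_lt. lra. Qed.

(** The steps from [n] on sum to at most [2 * (1 / 2) ^ n], so the intervals with these radii are
    nested. *)
Lemma clamped_cauchy (F : nat -> R) (m n : nat) :
  (m <= n)%nat ->
  clamped F m - 2 * (1 / 2) ^ m <= clamped F n - 2 * (1 / 2) ^ n /\
  clamped F n + 2 * (1 / 2) ^ n <= clamped F m + 2 * (1 / 2) ^ m.
Proof.
  intros H. induction H as [|n H IH]; [lra|].
  assert (Hn : clamped F n - (1 / 2) ^ n <= clamped F (S n) <= clamped F n + (1 / 2) ^ n).
  { simpl clamped. pose proof (half_pow_pos n).
    unfold Rmax, Rmin. repeat destruct Rle_dec; lra. }
  simpl pow. lra.
Qed.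

Lemma clamped_limit (F : nat -> R) :
  exists s, forall n, Rabs (s - clamped F n) <= 2 * (1 / 2) ^ n.
Proof.
  destruct (completeness (fun t => exists n, t = clamped F n - 2 * (1 / 2) ^ n))
    as [s [Hub Hlub]].
  - exists (clamped F 0 + 2). intros t [n ->].
    pose proof (clamped_cauchy F 0 n (Nat.le_0_l n)). simpl in *.
    pose proof (half_pow_pos n). lra.
  - exists (clamped F 0 - 2 * (1 / 2) ^ 0). exists O. reflexivity.
  - exists s. intros n. apply Rabs_le. split.
    + assert (clamped F n - 2 * (1 / 2) ^ n <= s) by (apply Hub; exists n; reflexivity). lra.
    + assert (s <= clamped F n + 2 * (1 / 2) ^ n); [|lra].
      apply Hlub. intros t [m ->].
      pose proof (half_pow_pos m). pose proof (half_pow_pos n).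
      destruct (Nat.le_ge_cases m n) as [Hmn|Hmn];
        pose proof (clamped_cauchy F _ _ Hmn); lra.
Qed.

(** By induction [a] lies in the interval to which [F (S n)] is clamped, and clamping to an interval
    containing [a] does not increase the distance to [a]. *)
Lemma clamped_approx (F : nat -> R) (a : R) :
  (forall n, Rabs (F n - a) <= (1 / 2) ^ n) ->
  forall n, Rabs (clamped F n - a) <= (1 / 2) ^ n.
Proof.
  intros H. induction n as [|n IH]; [exact (H O)|].
  specialize (H (S n)). apply Rabs_le_between in IH, H. apply Rabs_le_between.
  simpl clamped. unfold Rmax, Rmin. repeat destruct Rle_dec; lra.
Qed.

Lemma half_pow_small (e : R) : 0 < e -> exists n, (1 / 2) ^ n < e.
Proof.
  intros He. destruct (pow_lt_1_zero (1 / 2)) with (y := e) as [n Hn].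
  - rewrite Rabs_right; lra.
  - exact He.
  - exists n. specialize (Hn n (le_n _)). apply Rabs_def2 in Hn. lra.
Qed.

(* Clamping the steps makes the sequence converge uniformly on the whole cube,
   without changing its limit at the points where [F] converges fast enough. *)
Lemma uniform_limit (F : nat -> (nat -> I01) -> R) :
  (forall n, ord_uniform (F n)) ->
  exists s : (nat -> I01) -> I01, perfect_map (prod_open nat) up_open s /\
    forall v (a : I01), (forall n, Rabs (F n v - val a) <= (1 / 2) ^ n) -> s v = a.
Proof.
  intros HF.
  set (G := fun n v => clamped (fun k => F k v) n).
  assert (HG : forall n, ord_uniform (G n)).
  { induction n as [|n IH]; [exact (HF O)|].
    apply ord_uniform_max; [apply ord_uniform_shift, IH|].
    apply ord_uniform_min; [apply ord_uniform_shift, IH|apply HF]. }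
  set (s := fun v => proj1_sig (constructive_indefinite_description _
    (clamped_limit (fun k => F k v)))).
  assert (Hs : forall v n, Rabs (s v - G n v) <= 2 * (1 / 2) ^ n).
  { intros v. exact (proj2_sig (constructive_indefinite_description _
      (clamped_limit (fun k => F k v)))). }
  exists (fun v => clampI (s v)). split.
  - apply ord_uniform_perfect. intros e He.
    (* The errors at [v] and [w] are each at most [2 * (e / 8)], which leaves [e / 2] for [G n]. *)
    destruct (half_pow_small (e / 8)) as [n Hn]; [lra|].
    destruct (HG n (e / 2)) as [l [d [Hd H]]]; [lra|].
    exists l, d. split; [exact Hd|]. intros v w Hvw. specialize (H v w Hvw).
    pose proof (Hs v n) as Hv. pose proof (Hs w n) as Hw.
    apply Rabs_le_between in Hv, Hw. lra.
  - intros v a Ha.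
    assert (Hsa : s v = val a).
    { apply cond_eq. intros e He.
      (* The distances of [G n v] to [val a] and to [s v] add up to at most three times
         [(1 / 2) ^ n]. *)
      destruct (half_pow_small (e / 4)) as [n Hn]; [lra|].
      pose proof (clamped_approx (fun k => F k v) _ Ha n) as H1. cbv beta in H1.
      pose proof (Hs v n) as H2. unfold G in H2.
      apply Rabs_le_between in H1, H2. apply Rabs_def1; lra. }
    apply val_inj. simpl. rewrite Hsa. apply clamp01_id, val_range.
Qed.

(** * Finite suprema and the factorization *)

Definition list_sup {A : Type} (phi : A -> R) (l : list A) : R :=
  fold_right (fun a r => Rmax (phi a) r) 0 l.

Lemma list_sup_ge {A : Type} (phi : A -> R) (l : list A) (a : A) :
  In a l -> phi a <= list_sup phi l.
Proof.
  induction l as [|b l IH]; [intros []|]. intros [<-|Ha]; simpl.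
  - apply Rmax_l.
  - eapply Rle_trans; [apply IH, Ha|apply Rmax_r].
Qed.

Lemma list_sup_le {A : Type} (phi : A -> R) (l : list A) (b : R) :
  0 <= b -> (forall a, In a l -> phi a <= b) -> list_sup phi l <= b.
Proof.
  intros Hb. induction l as [|a l IH]; intros H; simpl; [exact Hb|].
  apply Rmax_lub; [apply H; left; reflexivity|]. apply IH. intros a' Ha'. apply H. right. exact Ha'.
Qed.

Lemma list_sup_ord_uniform {A : Type} (phi : A -> (nat -> I01) -> R) (l : list A) :
  (forall a, In a l -> ord_uniform (phi a)) ->
  ord_uniform (fun v => list_sup (fun a => phi a v) l).
Proof.
  induction l as [|a l IH]; intros H; simpl; [apply ord_uniform_const|].
  apply ord_uniform_max; [apply H; left; reflexivity|].
  apply IH. intros b Hb. apply H. right. exact Hb.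
Qed.

Theorem theorem5p17 (X : Type)
  (f : VU (prod_open X) -> I01)
  (hf : perfect_map (VU_open (prod_open X)) up_open f) :
  exists Y : Type, at_most_countable Y /\
  exists s : (Y -> I01) -> I01, perfect_map (prod_open Y) up_open s /\
  exists h : Y -> (X -> I01) -> I01,
    (forall y, perfect_map (prod_open X) up_open (h y)) /\
    forall K : VU (prod_open X),
      f K = s (fun y => box (Vup_map up_open (h y) (proj1_sig K))).
Proof.
  set (L := fun n => proj1_sig (constructive_indefinite_description _
    (approximation X f ((1 / 2) ^ n) hf (half_pow_pos n)))).
  assert (HL : forall n,
    (forall p, In p (L n) -> 0 <= fst p <= 1 /\
       perfect_map (prod_open X) up_open (snd p) /\
       forall K, fst p * inf_on (snd p) (proj1_sig K) <= val (f K) + (1 / 2) ^ n) /\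
    (forall K, exists p, In p (L n) /\
       val (f K) - (1 / 2) ^ n <= fst p * inf_on (snd p) (proj1_sig K))).
  { intros n. exact (proj2_sig (constructive_indefinite_description _
      (approximation X f ((1 / 2) ^ n) hf (half_pow_pos n)))). }
  set (p0 := (0, fun _ : X -> I01 => clampI 0)).
  set (p := fun n i => nth i (L n) p0).
  (* Coordinate [to_nat (n, i)] carries the [i]-th function of stage [n]; past the end of [L n] the
     default [p0] supplies the constant 0. *)
  set (h := fun y => snd (p (fst (of_nat y)) (snd (of_nat y)))).
  set (F := fun n (v : nat -> I01) =>
    list_sup (fun i => fst (p n i) * val (v (to_nat (n, i)))) (seq 0 (length (L n)))).
  assert (Hin : forall n i, In i (seq 0 (length (L n))) -> In (p n i) (L n)).
  { intros n i Hi. apply in_seq in Hi. apply nth_In. lia. }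
  destruct (uniform_limit F) as [s [Hs Hlim]].
  { intros n. apply list_sup_ord_uniform. intros i Hi.
    apply ord_uniform_scale. apply (HL n), Hin, Hi. }
  exists nat. split; [exists (fun n => n); auto|].
  exists s. split; [exact Hs|].
  exists h. split.
  - intros y. unfold h, p.
    destruct (nth_in_or_default (snd (of_nat y)) (L (fst (of_nat y))) p0) as [H|H].
    + apply (HL (fst (of_nat y))), H.
    + rewrite H. apply perfect_real_clampI; [intros; lra|apply perfect_real_zero].
  (* It suffices that [F n] at the tuple of boxes is within [(1 / 2) ^ n] of [f K]: one pair of
     [L n] gives the lower bound, and all pairs together the upper bound. *)
  - intros K. symmetry. apply Hlim. intros n.
    assert (Hh : forall i, val (box (Vup_map up_open (h (to_nat (n, i))) (proj1_sig K))) =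
      inf_on (snd (p n i)) (proj1_sig K)).
    { intros i. unfold h. rewrite cancel_of_to. reflexivity. }
    apply Rabs_le_between. split.
    + destruct (proj2 (HL n) K) as [q [Hq Hqf]].
      destruct (In_nth _ _ p0 Hq) as [i [Hi <-]].
      assert (H : In i (seq 0 (length (L n)))) by (apply in_seq; lia).
      pose proof (list_sup_ge (fun i => fst (p n i) *
        val (box (Vup_map up_open (h (to_nat (n, i))) (proj1_sig K)))) _ i H) as H1.
      cbv beta in H1. rewrite Hh in H1. unfold F, p in *. lra.
    + assert (F n (fun y => box (Vup_map up_open (h y) (proj1_sig K))) <=
        val (f K) + (1 / 2) ^ n); [|lra].
      apply list_sup_le.
      * pose proof (val_range (f K)). pose proof (half_pow_pos n). lra.
      * intros i Hi. rewrite Hh. apply (HL n), Hin, Hi.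
Qed.
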